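(* Let $\mathcal{A}$ be a complex Banach algebra with unity and $a\in\mathcal{A}$. The following are equivalent: (1) $a$ is g$\pi$-Hirano invertible; (2) $a-a^{n+1}\in\mathcal{A}^{qnil}$ for some positive integer $n$; (3) $a^{m}-a^{n}\in\mathcal{A}^{qnil}$ for some positive integers $m,n$ with $m\neq n$.
   Context: $\mathcal{A}^{qnil}$ denotes the set of quasinilpotent elements of $\mathcal{A}$, i.e. those $q$ with spectrum $\sigma(q)=\{0\}$. An element $a\in\mathcal{A}$ is g$\pi$-Hirano invertible if there exists $x\in\mathcal{A}$ with $xax=x$, $ax=xa$ and $a-a^{n+2}x\in\mathcal{A}^{qnil}$ for some positive integer $n$. *)

(* Defs.v *)
From HB Require Import structures.
From mathcomp Require Import all_boot all_order all_algebra.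
From mathcomp Require Import all_classical all_reals.
From mathcomp Require Import complex.
Set Implicit Arguments. Unset Strict Implicit. Unset Printing Implicit Defensive.
Import Order.TTheory GRing.Theory Num.Theory.
Local Open Scope ring_scope.
Local Open Scope complex_scope.

Record banach_norm (R : realType) (A : algType R[i]) := BanachNorm {
  nrm : A -> R;
  nrm_ge0 : forall x, 0 <= nrm x;
  nrm_eq0 : forall x, nrm x = 0 -> x = 0;
  nrm_triangle : forall x y, nrm (x + y) <= nrm x + nrm y;
  nrm_scale : forall (k : R[i]) x, (nrm (k *: x))%:C = `|k| * (nrm x)%:C;
  nrm_mul : forall x y, nrm (x * y) <= nrm x * nrm y;
  nrm_complete : forall u : nat -> A,
    (forall e : R, 0 < e -> exists N, forall m n, (N <= m)%N -> (N <= n)%N ->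
       nrm (u m - u n) < e) ->
    exists l : A, forall e : R, 0 < e -> exists N, forall n, (N <= n)%N ->
       nrm (u n - l) < e
}.

Definition invertible (A : pzRingType) (x : A) : Prop :=
  exists y : A, x * y = 1 /\ y * x = 1.

Definition spectrum (R : realType) (A : algType R[i]) (a : A) : set R[i] :=
  [set lambda | ~ invertible (lambda%:A - a)]%classic.

Definition qnil (R : realType) (A : algType R[i]) (q : A) : Prop :=
  spectrum q = [set 0]%classic.

Definition gpi_Hirano_invertible (R : realType) (A : algType R[i]) (a : A)
  : Prop :=
  exists x : A, [/\ x * a * x = x, a * x = x * a &
    exists2 n : nat, (0 < n)%N & qnil (a - a ^+ n.+2 * x)].

(* Main.v *)
(** If [a - a^(n+1)] is quasinilpotent then [e = a^n] is idempotent up to the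
    quasinilpotent [e - e^2], so a power series in [e - e^2] corrects [e] to an
    idempotent [p] commuting with [a]; [1 - (p - e)] is invertible, and
    [x = a^(n-1) (1 - (p - e))^-1 p] is the required inverse.  The other
    implications only use that a quasinilpotent times an element commuting with
    it is quasinilpotent.  Both rest on Gelfand's theorem that quasinilpotents
    have spectral radius zero, obtained here without contour integrals, by
    averaging the resolvent over roots of unity. *)

Require Import Defs.
From HB Require Import structures.
From mathcomp Require Import all_boot all_order all_algebra.
From mathcomp Require Import all_classical all_reals.
From mathcomp Require Import complex.
From mathcomp Require Import topology normedtype sequences lra.
Import Order.TTheory GRing.Theory Num.Theory.
Import numFieldNormedType.Exports.
Local Open Scope ring_scope.
Local Open Scope complex_scope.

Set Implicit Arguments.
Unset Strict Implicit.

(** * Two facts of real analysis *)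

Lemma expr_lt_eps (R : realType) (t e : R) : 0 <= t -> t < 1 -> 0 < e ->
  exists K, forall k, (K <= k)%N -> t ^+ k < e.
Proof.
move=> t0 t1 e0.
have tn : `|t| < 1 by rewrite ger0_norm.
have /cvgrPdist_lt /(_ e e0) [K _ HK] := cvg_expr tn.
exists K => k /HK /=; rewrite sub0r normrN ger0_norm // exprn_ge0 //.
Qed.

(** Compactness of the square, in its near-covering form along the filter of bounds tending to
    +oo. *)
Lemma locally_bounded_rectangle (R : realType) (f : R -> R -> R) (M : R) :
  (forall x y, exists d B, 0 < d /\ forall x' y',
     `|x - x'| < d -> `|y - y'| < d -> f x' y' <= B) ->
  exists B, forall x y, `|x| <= M -> `|y| <= M -> f x y <= B.
Proof.
move=> H.
pose K := (`[- M, M]%classic `*` `[- M, M]%classic)%classic : set (R * R).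
have cK : compact K by apply: compact_setX; exact: segment_compact.
have /compact_near_coveringP := cK.
move=> /(_ R (pinfty_nbhs R) (fun B z => f z.1 z.2 <= B) _) [].
  move=> [x y] _; have [d [B [d0 HB]]] := H x y.
  exists (ball (x, y) d, [set b | B < b]%classic) => /=.
    split; first exact: nbhsx_ballx.
    by exists B; split; [exact: num_real|].
  move=> [[x' y'] b] /= [[hx hy] hb].
  by apply: le_trans (HB _ _ hx hy) (ltW hb).
move=> B [_ HB]; exists (B + 1) => x y hx hy.
apply: (HB (B + 1) _ (x, y)); first by rewrite ltrDl.
by split; rewrite /= in_itv /= -ler_norml.
Qed.

Section BanachAlgebra.
Variables (R : realType) (A : algType R[i]) (N : banach_norm A).
Implicit Types (a b c q u v w x y z : A) (k : R[i]).

Local Notation "|[ x ]|" := (nrm N x).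
Local Notation absc := Normc.normc.

(** * Norm and limits of sequences in a Banach algebra *)

Lemma nrmZ k x : |[k *: x]| = absc k * |[x]|.
Proof.
have := nrm_scale N k x; rewrite -[`|k|]/((absc k)%:C) -rmorphM /=.
by case.
Qed.

Lemma nrm0 : |[0 : A]| = 0.
Proof. by rewrite -(scale0r (0 : A)) nrmZ Normc.normc0 mul0r. Qed.

Lemma nrmN x : |[- x]| = |[x]|.
Proof. by rewrite -scaleN1r nrmZ normcN Normc.normc1 mul1r. Qed.

Lemma nrm_distC x y : |[x - y]| = |[y - x]|.
Proof. by rewrite -nrmN opprB. Qed.

Lemma nrm_dist3 y x z : |[x - z]| <= |[x - y]| + |[y - z]|.
Proof. by rewrite -{1}(subrK y x) -addrA; exact: nrm_triangle. Qed.

Definition ncvg (s : nat -> A) (l : A) : Prop :=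
  forall e : R, 0 < e -> exists K, forall n, (K <= n)%N -> |[s n - l]| < e.

Lemma ncvg_unique s l l' : ncvg s l -> ncvg s l' -> l = l'.
Proof.
move=> H H'; apply/eqP; rewrite -subr_eq0; apply/eqP/(@nrm_eq0 _ _ N).
apply/eqP; rewrite eq_le nrm_ge0 andbT leNgt; apply/negP => e0.
have e2 : 0 < |[l - l']| / 2 by lra.
have [K HK] := H _ e2; have [K' HK'] := H' _ e2.
have h := HK _ (leq_maxl K K'); have h' := HK' _ (leq_maxr K K').
by have := nrm_dist3 (s (maxn K K')) l l'; rewrite (nrm_distC l (s _)); lra.
Qed.

Lemma ncvg_ext s s' l : s =1 s' -> ncvg s l -> ncvg s' l.
Proof.
by move=> E H e /H [K HK]; exists K => n /HK; rewrite E.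
Qed.

Lemma ncvg_cst l : ncvg (fun=> l) l.
Proof. by move=> e e0; exists 0%N => n _; rewrite subrr nrm0. Qed.

Lemma ncvg_shift s l : ncvg s l -> ncvg (fun n => s n.+1) l.
Proof.
by move=> H e /H [K HK]; exists K => n Kn; apply/HK/leqW.
Qed.

Lemma ncvgD s s' l l' : ncvg s l -> ncvg s' l' ->
  ncvg (fun n => s n + s' n) (l + l').
Proof.
move=> H H' e e0; have e2 : 0 < e / 2 by lra.
have [K HK] := H _ e2; have [K' HK'] := H' _ e2.
exists (maxn K K') => n; rewrite geq_max => /andP[/HK h /HK' h'].
rewrite opprD addrACA; apply: le_lt_trans (nrm_triangle _ _ _) _; lra.
Qed.

Lemma ncvgM s s' l l' : ncvg s l -> ncvg s' l' ->
  ncvg (fun n => s n * s' n) (l * l').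
Proof.
move=> H H' e e0.
have := nrm_ge0 N l; have := nrm_ge0 N l'.
set L := |[l]|; set L' := |[l']| => L'0 L0.
pose d := Num.min 1 (e / (L + L' + 2)).
have d0 : 0 < d by rewrite lt_min ltr01 divr_gt0 //; lra.
have d1 : d <= 1 by rewrite ge_min lexx.
have dL : d * (L + L' + 2) <= e.
  by rewrite -ler_pdivlMr ?ge_min ?lexx ?orbT //; lra.
have [K HK] := H _ d0; have [K' HK'] := H' _ d0.
exists (maxn K K') => n; rewrite geq_max => /andP[/HK h /HK' h'].
have -> : s n * s' n - l * l' = (s n - l) * s' n + l * (s' n - l').
  by rewrite mulrBl mulrBr addrA subrK.
have hs' : |[s' n]| <= L' + 1.
  by have := nrm_triangle N (s' n - l') l'; rewrite subrK -/L'; lra.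
apply: le_lt_trans (nrm_triangle _ _ _) _.
have h1 : |[(s n - l) * s' n]| <= d * (L' + 1).
  apply: le_trans (nrm_mul _ _ _) _; apply: ler_pM; rewrite ?nrm_ge0 //.
  exact: ltW.
have h2 : |[l * (s' n - l')]| <= L * d.
  by apply: le_trans (nrm_mul _ _ _) _; apply: ler_wpM2l => //; exact: ltW.
by nra.
Qed.

Lemma ncvg_geometric s (C : R) :
  (forall n, |[s n.+1 - s n]| <= C * 2^-1 ^+ n) -> exists l, ncvg s l.
Proof.
move=> H.
have C0 : 0 <= C by have := H 0%N; rewrite expr0 mulr1; apply: le_trans (nrm_ge0 _ _).
(* The exact partial geometric sum is kept on the right, since then the induction on [m] closes with
   equality. *)
have tail n m : |[s (n + m)%N - s n]| <= 2 * C * 2^-1 ^+ n * (1 - 2^-1 ^+ m).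
  elim: m => [|m IH]; first by rewrite addn0 subrr nrm0 expr0 subrr mulr0.
  have := nrm_dist3 (s (n + m)%N) (s (n + m.+1)%N) (s n).
  have := H (n + m)%N; rewrite -addnS exprD exprS.
  move: IH; set X := 2^-1 ^+ n; set Y := 2^-1 ^+ m; nra.
apply: (@nrm_complete _ _ N) => e e0.
have e1 : 0 < e / (4 * C + 1) by apply: divr_gt0 => //; lra.
have h0 : 0 <= 2^-1 :> R by lra.
have h1 : 2^-1 < 1 :> R by lra.
have [K HK] := expr_lt_eps h0 h1 e1.
have {}HK : 4 * C * 2^-1 ^+ K < e.
  have := HK _ (leqnn K); rewrite ltr_pdivlMr; last lra.
  have : 0 <= (2^-1 : R) ^+ K by exact: exprn_ge0.
  by nra.
have near n : (K <= n)%N -> |[s n - s K]| <= 2 * C * 2^-1 ^+ K.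
  move=> /subnKC <-; apply: le_trans (tail _ _) _.
  have : 0 <= (2^-1 : R) ^+ (n - K) by exact: exprn_ge0.
  have : 0 <= (2^-1 : R) ^+ K by exact: exprn_ge0.
  set X := _ ^+ K; set Y := _ ^+ _ => X0 Y0.
  have : 0 <= C * X * Y by rewrite !mulr_ge0.
  nra.
exists K => m n /near hm /near hn.
have := nrm_dist3 (s K) (s m) (s n); rewrite (nrm_distC (s K) (s n)); lra.
Qed.

Lemma ncvg_comm s l b : ncvg s l -> (forall n, GRing.comm b (s n)) ->
  GRing.comm b l.
Proof.
move=> H Hb; apply: (@ncvg_unique (fun n => b * s n)).
  exact: ncvgM (ncvg_cst b) H.
by apply: ncvg_ext (ncvgM H (ncvg_cst b)) => n; rewrite /= Hb.
Qed.

(** * Elements of spectral radius zero and power series in them *)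

Lemma nrmX c n : |[c ^+ n]| <= |[1 : A]| * |[c]| ^+ n.
Proof.
elim: n => [|n IH]; first by rewrite !expr0 mulr1.
rewrite exprSr [_ ^+ n.+1]exprSr mulrA; apply: le_trans (nrm_mul _ _ _) _.
by apply: ler_wpM2r => //; exact: nrm_ge0.
Qed.

(* Spectral radius zero, stated without roots. *)
Definition tnil q : Prop :=
  forall r : R, 0 < r -> exists C : R, forall j, |[q ^+ j]| <= C * r ^+ j.

Lemma tnilM q c : GRing.comm q c -> tnil q -> tnil (q * c).
Proof.
move=> qc H r r0.
have L0 := nrm_ge0 N c; set L := |[c]| in L0.
have L1 : 0 < L + 1 by lra.
(* The rate [r / (L + 1)] absorbs the growth [L ^ j] of the powers of [c]; the [+ 1] keeps the
   divisor positive. *)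
have [C HC] := H _ (divr_gt0 r0 L1).
have C0 : 0 <= C.
  by have := HC 0%N; rewrite !expr0 mulr1; apply: le_trans (nrm_ge0 _ _).
exists (C * |[1 : A]|) => j; rewrite exprMn_comm //.
apply: le_trans (nrm_mul _ _ _) _.
apply: le_trans (ler_pM (nrm_ge0 _ _) (nrm_ge0 _ _) (HC j) (nrmX _ _)) _.
rewrite mulrACA -exprMn; apply: ler_wpM2l.
  by rewrite mulr_ge0 ?nrm_ge0.
apply: lerXn2r; rewrite ?nnegrE ?mulr_ge0 ?invr_ge0 ?(ltW r0) ?(ltW L1) //.
by rewrite -/L mulrAC ler_pdivrMr // ler_wpM2l ?(ltW r0) //; lra.
Qed.

(** Neumann series, with partial sums in Horner form so that the limit satisfies [y = 1 + w * y] at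
    once. *)
Lemma tnil_invertible_1B w : tnil w -> invertible (1 - w).
Proof.
move=> H.
pose s := fix s n := if n is m.+1 then 1 + w * s m else 0 : A.
have sS n : s n.+1 - s n = w ^+ n.
  elim: n => [|n IH]; first by rewrite /= mulr0 addr0 subr0.
  by rewrite exprS -IH mulrBr /= opprD addrACA subrr add0r.
have sC n : GRing.comm w (s n).
  elim: n => [|n IH]; first exact: commr0.
  by apply: commrD; [exact: commr1|exact: commrM].
have h : 0 < 2^-1 :> R by lra.
have [C HC] := H _ h.
have [|y Hy] := @ncvg_geometric s C; first by move=> n; rewrite sS.
have E : y = 1 + w * y.
  apply: (@ncvg_unique (fun n => s n.+1)); first exact: ncvg_shift.
  exact: ncvgD (ncvg_cst _) (ncvgM (ncvg_cst _) Hy).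
have wy : w * y = y * w by exact: ncvg_comm Hy sC.
by exists y; rewrite mulrBl mulrBr !(mul1r, mulr1) -wy {1 3}E addrK.
Qed.

(* The Catalan generating function evaluated at [z].  Left multiplications are
   measured in the norm [sup_j |z^j v| / 8^-j], for which [z] has size at
   most 1/8, so that the iteration [c := 1 + z c^2] contracts. *)
Lemma tnil_catalan z : tnil z ->
  exists c, c = 1 + z * (c * c) /\
            forall b, GRing.comm b z -> GRing.comm b c.
Proof.
move=> H; pose r : R := 8^-1.
have r0 : 0 < r by rewrite /r; lra.
have [C HC] := H _ r0.
(* [Bd w b]: left multiplication by [w] has operator norm at most [b] for the weighted norm. *)
pose Bd w (b : R) := forall v (B : R), (forall j, |[z ^+ j * v]| <= B * r ^+ j) ->
  forall j, |[z ^+ j * (w * v)]| <= b * B * r ^+ j.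
have Bdle w (b b' : R) : b <= b' -> Bd w b -> Bd w b'.
  move=> bb Hw v B Hv j; apply: le_trans (Hw _ _ Hv j) _.
  apply: ler_wpM2r; first by rewrite exprn_ge0 // ltW.
  apply: ler_wpM2r => //.
  by have := Hv 0%N; rewrite !expr0 mulr1; apply: le_trans (nrm_ge0 _ _).
have Bd1 : Bd 1 1 by move=> v B Hv j; rewrite !mul1r.
have Bdz : Bd z r by move=> v B Hv j; rewrite mulrA -exprSr [r * B]mulrC -mulrA -exprS.
have BdM w w' (b b' : R) : Bd w b -> Bd w' b' -> Bd (w * w') (b * b').
  move=> Hw Hw' v B Hv j; rewrite -mulrA -(mulrA b).
  by apply: Hw => i; exact: Hw'.
have BdD w w' (b b' : R) : Bd w b -> Bd w' b' -> Bd (w + w') (b + b').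
  move=> Hw Hw' v B Hv j; rewrite mulrDl mulrDr !mulrDl.
  by apply: le_trans (nrm_triangle _ _ _) _; apply: lerD; [exact: Hw|exact: Hw'].
pose s := fix s n := if n is m.+1 then 1 + z * (s m * s m) else 1 : A.
(* The bound 2 reproduces itself: 1 + (1/8) 2^2 <= 2. The contraction factor below is then (1/8)(2 +
   2) = 1/2. *)
have Bds n : Bd (s n) 2.
  elim: n => [|n IH] /=; first by apply: Bdle Bd1; lra.
  apply: Bdle (BdD _ _ _ _ Bd1 (BdM _ _ _ _ Bdz (BdM _ _ _ _ IH IH))).
  by rewrite /r; lra.
have Bdd n : Bd (s n.+1 - s n) (2^-1 ^+ n).
  elim: n => [|n IH].
    by rewrite /= !mulr1 addrAC subrr add0r expr0; apply: Bdle Bdz; rewrite /r; lra.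
  have -> : s n.+2 - s n.+1 =
     z * (s n.+1 * (s n.+1 - s n) + (s n.+1 - s n) * s n).
    by rewrite mulrBr mulrBl addrA subrK mulrBr [LHS]/= opprD addrACA subrr add0r.
  apply: Bdle (BdM _ _ _ _ Bdz (BdD _ _ _ _ (BdM _ _ _ _ (Bds _) IH)
    (BdM _ _ _ _ IH (Bds _)))).
  by rewrite exprS /r; lra.
have [|c Hc] := @ncvg_geometric s C.
  (* Applying the operator bound to [v = 1] and reading it at [j = 0] returns to the original
     norm. *)
  move=> n; have := Bdd n 1 C; move=> /(_ _ 0%N).
  rewrite !expr0 mul1r !mulr1 mulrC; apply => j; rewrite mulr1; exact: HC.
exists c; split.
  apply: (@ncvg_unique (fun n => s n.+1)); first exact: ncvg_shift.
  exact: ncvgD (ncvg_cst _) (ncvgM (ncvg_cst _) (ncvgM Hc Hc)).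
move=> b bz; apply: ncvg_comm Hc _; elim=> [|n IH]; first exact: commr1.
by apply: commrD; [exact: commr1|do 2! apply: commrM => //].
Qed.

(** * Complex moduli and roots of unity *)

Lemma absc_leD (x y : R) : absc (x +i* y) <= `|x| + `|y|.
Proof.
rewrite /absc -[leRHS]ger0_norm ?addr_ge0 // -sqrtr_sqr; apply: ler_wsqrtr.
by rewrite sqrrD !real_normK ?num_real // lerD2r lerDl mulrn_wge0 // mulr_ge0.
Qed.

Lemma absc_ge_Re (x y : R) : `|x| <= absc (x +i* y).
Proof. by rewrite /absc -sqrtr_sqr; apply: ler_wsqrtr; rewrite lerDl sqr_ge0. Qed.

Lemma absc_ge_Im (x y : R) : `|y| <= absc (x +i* y).
Proof. by rewrite /absc -sqrtr_sqr; apply: ler_wsqrtr; rewrite lerDr sqr_ge0. Qed.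

Lemma absc_real (x : R) : absc x%:C = `|x|.
Proof. by rewrite /absc /= expr0n /= addr0 sqrtr_sqr. Qed.

Lemma absc_ge0 k : 0 <= absc k.
Proof. by case: k => x y; exact: sqrtr_ge0. Qed.

(** A primitive 2^(n+1)-th root of unity; multiplying [k] by it changes the sign of
    [(k *: q) ^+ (2 ^ n)]. *)
Fixpoint root_N1 (n : nat) : R[i] :=
  if n is m.+1 then sqrtc (root_N1 m) else -1.

Lemma root_N1X n : root_N1 n ^+ (2 ^ n) = -1.
Proof.
elim: n => [|n IH]; first by rewrite expn0 expr1.
by rewrite expnS exprM /= sqr_sqrtc.
Qed.

Lemma absc_root_N1 n : absc (root_N1 n) = 1.
Proof.
elim: n => [|n IH]; first exact: etrans (normcN _) (Normc.normc1 _).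
apply/eqP; rewrite -(@eqrXn2 _ 2) ?absc_ge0 //.
by rewrite expr1n expr2 -Normc.normcM -expr2 sqr_sqrtc IH.
Qed.

(** * The resolvent [(1 - k q)^-1] on the whole plane and its averages *)

Section Resolvent.
Variables (q : A) (res : R[i] -> A).
Hypothesis res_l : forall k, res k * (1 - k *: q) = 1.
Hypothesis res_r : forall k, (1 - k *: q) * res k = 1.

Lemma resolvent_identity k k' :
  res k - res k' = (k - k') *: (res k * q * res k').
Proof.
have -> : res k - res k' = res k * ((1 - k' *: q) - (1 - k *: q)) * res k'.
  by rewrite mulrBr mulrBl res_l mul1r -mulrA res_r mulr1.
rewrite opprB [X in _ * X * _]addrC addrA subrK -scalerBl.
by rewrite -scalerAr -scalerAl.
Qed.

(** Near [k] the resolvent identity gives |res k'| <= |res k| + |res k'| / 2, hence a local bound 2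
    |res k|; compactness makes it uniform. *)
Lemma resolvent_bounded (M : R) :
  exists B : R, forall k, absc k <= M -> |[res k]| <= B.
Proof.
have [x0 y0|B HB] := @locally_bounded_rectangle _ (fun x y : R => |[res (x +i* y)]|) M.
  set k := x0 +i* y0.
  pose D := |[q]| * |[res k]|.
  have D0 : 0 <= D by rewrite mulr_ge0 ?nrm_ge0.
  (* Both coordinates being this close, |k' - k| is at most twice this radius, so |k' - k| D <=
     1/2. *)
  exists (4 * (D + 1))^-1, (2 * |[res k]|); split.
    by rewrite invr_gt0; lra.
  move=> x1 y1 hx hy; set k' := x1 +i* y1.
  have hk : absc (k' - k) * D <= 2^-1.
    have : absc (k' - k) <= 2 * (4 * (D + 1))^-1.
      apply: le_trans (absc_leD _ _) _.
      by rewrite distrC [X in _ + X]distrC; lra.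
    move=> h; apply: le_trans (ler_wpM2r D0 h) _.
    rewrite mulrAC ler_pdivrMr; lra.
  have : |[res k' - res k]| <= |[res k']| * 2^-1.
    rewrite resolvent_identity nrmZ.
    apply: le_trans (ler_wpM2l (absc_ge0 _) (nrm_mul _ _ _)) _.
    apply: le_trans (ler_wpM2l (absc_ge0 _) (ler_wpM2r (nrm_ge0 _ _) (nrm_mul _ _ _))) _.
    rewrite -mulrA mulrCA; apply: ler_wpM2l => //; exact: nrm_ge0.
  have := nrm_triangle N (res k' - res k) (res k); rewrite subrK; lra.
exists B => -[x y] hk; apply: HB; apply: le_trans hk.
  exact: absc_ge_Re.
exact: absc_ge_Im.
Qed.

Lemma resolvent_lipschitz (M : R) : exists L : R, 0 <= L /\
  forall k k', absc k <= M -> absc k' <= M ->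
    |[res k - res k']| <= L * absc (k - k').
Proof.
have [B HB] := resolvent_bounded M.
(* [B] may be negative when the disc is empty, hence the absolute values. *)
exists (`|B| * |[q]| * `|B|); split; first by rewrite !mulr_ge0 ?nrm_ge0.
move=> k k' /HB hk /HB hk'; rewrite resolvent_identity nrmZ mulrC.
apply: ler_wpM2r; first exact: absc_ge0.
apply: le_trans (nrm_mul _ _ _) _; apply: ler_pM; rewrite ?nrm_ge0 //.
  apply: le_trans (nrm_mul _ _ _) _; apply: ler_pM; rewrite ?nrm_ge0 //.
  exact: le_trans hk (ler_norm _).
exact: le_trans hk' (ler_norm _).
Qed.

(* [res_avg n k] is the average of [res] over the 2^n-th roots of unity times k. *)
Fixpoint res_avg (n : nat) k : A :=
  if n is m.+1 then 2^-1 *: (res_avg m k + res_avg m (root_N1 m * k)) else res k.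

(** With [y = (k *: q) ^+ (2 ^ n)], the two averaged terms are the inverses of [1 - y] and [1 + y],
    and their mean is the inverse of [1 - y * y]. *)
Lemma res_avgP n k : res_avg n k * (1 - (k *: q) ^+ (2 ^ n)) = 1.
Proof.
elim: n k => [|n IH] k; first by rewrite expn0 expr1; exact: res_l.
rewrite /= expnS mulnC exprM expr2; have h := IH k; have := IH (root_N1 n * k).
rewrite -scalerA exprZn root_N1X scaleN1r opprK.
set y := (k *: q) ^+ _ in h *; set g := res_avg _ k in h *.
set g' := res_avg _ _ => h'.
have E : 1 - y * y = (1 + y) * (1 - y).
  by rewrite mulrBr mulr1 mulrDl mul1r opprD addrA addrK.
have E' : 1 - y * y = (1 - y) * (1 + y).
  by rewrite mulrDr mulr1 mulrBl mul1r addrA subrK.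
rewrite -scalerAl mulrDl {1}E' E !mulrA h h' !mul1r.
rewrite addrACA subrr addr0.
have -> : 1 + 1 = (2 : R[i]) *: (1 : A) by rewrite scaler_nat mulr2n.
by rewrite scalerA mulVf ?scale1r // pnatr_eq0.
Qed.

(** Multiplication by a root of unity preserves moduli, so averaging keeps the constant [L],
    whatever [n] is. *)
Lemma res_avg_lipschitz (M L : R) :
  (forall k k', absc k <= M -> absc k' <= M ->
     |[res k - res k']| <= L * absc (k - k')) ->
  forall n k k', absc k <= M -> absc k' <= M ->
     |[res_avg n k - res_avg n k']| <= L * absc (k - k').
Proof.
move=> H; elim=> [|n IH] k k' hk hk' /=; first exact: H.
have half : absc (2^-1 : R[i]) = 2^-1.
  have -> : (2^-1 : R[i]) = (2^-1)%:C by rewrite fmorphV rmorph_nat.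
  by rewrite absc_real ger0_norm ?invr_ge0.
rewrite -scalerBr nrmZ half opprD addrACA mulrC ler_pdivrMr //.
apply: le_trans (nrm_triangle _ _ _) _.
have h1 := IH _ _ hk hk'.
have := IH (root_N1 n * k) (root_N1 n * k').
rewrite -mulrBr !Normc.normcM absc_root_N1 !mul1r => /(_ hk hk'); lra.
Qed.

(** From [1 - g = (1 - g) * y - y]: |1 - g| <= |y| / (1 - |y|) <= 1/7. *)
Lemma inv_1B_near1 g y : g * (1 - y) = 1 -> |[y]| <= 8^-1 -> |[1 - g]| <= 4^-1.
Proof.
rewrite mulrBr mulr1 => E hy.
have : |[1 - g]| <= |[y]| + |[1 - g]| * |[y]|.
  rewrite -{1}E addrAC subrr add0r.
  have -> : - (g * y) = (1 - g) * y - y by rewrite mulrBl mul1r addrAC subrr add0r.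
  rewrite addrC; apply: le_trans (nrm_triangle _ _ _) _.
  by rewrite nrmN lerD2l; exact: nrm_mul.
by have := nrm_ge0 N (1 - g); nra.
Qed.

(** From [y = (1 - g) * y - (1 - g)]: |y| <= |1 - g| / (1 - |1 - g|). *)
Lemma near1_inv_1B g y : g * (1 - y) = 1 -> |[1 - g]| <= 2^-1 -> |[y]| <= 1.
Proof.
rewrite mulrBr mulr1 => E hg.
have : |[y]| <= |[1 - g]| + |[1 - g]| * |[y]|.
  have Eg : 1 - g = - (g * y) by rewrite -{1}E addrAC subrr add0r.
  have Ey : y = (1 - g) * y - (1 - g) by rewrite {2}Eg opprK mulrBl mul1r subrK.
  rewrite {1}Ey addrC; apply: le_trans (nrm_triangle _ _ _) _.
  by rewrite nrmN lerD2l; exact: nrm_mul.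
by have := nrm_ge0 N y; nra.
Qed.

End Resolvent.

(** * Gelfand's theorem for quasinilpotent elements *)

(** One exponent [n] with |q^n| <= r^n controls all others: remove [n] from [j] repeatedly until a
    remainder below [n] is left, whose contribution goes into the constant. *)
Lemma expr_nrm_le_tnil q :
  (forall M : R, 0 < M -> exists2 n, (0 < n)%N & M ^+ n * |[q ^+ n]| <= 1) ->
  tnil q.
Proof.
move=> H r r0; have [n n0 Hn] := H r^-1 (etrans (invr_gt0 r) r0).
have rX j : 0 < r ^+ j by rewrite exprn_gt0.
have {}Hn : |[q ^+ n]| <= r ^+ n.
  by move: Hn; rewrite exprVn mulrC ler_pdivrMr // mul1r.
exists (\sum_(i < n) |[q ^+ i]| / r ^+ i) => j; set C := \sum_(i < n) _.
elim/ltn_ind: j => j IH; have [jn|nj] := ltnP j n.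
  rewrite -ler_pdivrMr // /C (bigD1 (Ordinal jn)) //= lerDl sumr_ge0 // => i _.
  by rewrite divr_ge0 ?nrm_ge0 // ltW.
rewrite -(subnKC nj) !exprD; apply: le_trans (nrm_mul _ _ _) _.
rewrite mulrCA; apply: ler_pM; rewrite ?nrm_ge0 //; apply: IH.
by rewrite ltn_subrL n0 (leq_trans n0 nj).
Qed.

(* If [(s q)^(2^k)] tends to 0, the averaged resolvent [(1 - (s q)^(2^k))^-1]
   tends to 1; by the Lipschitz bound, uniform in [k], it stays within 1/2 of 1
   slightly further out, where [(s' q)^(2^k)] is therefore still bounded. *)
Lemma res_tnil q (res : R[i] -> A) :
  (forall k, res k * (1 - k *: q) = 1) -> (forall k, (1 - k *: q) * res k = 1) ->
  tnil q.
Proof.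
move=> Hl Hr; apply: expr_nrm_le_tnil => M M0.
have [L [L0 /(res_avg_lipschitz) HL]] := resolvent_lipschitz Hl Hr (2 * M).
pose Y (s : R) (n : nat) := |[(s%:C *: q) ^+ (2 ^ n)]|.
have YE (s : R) (k : nat) : 0 <= s -> Y s k = s ^+ (2 ^ k) * |[q ^+ (2 ^ k)]|.
  move=> s0; rewrite /Y exprZn nrmZ -rmorphXn absc_real ger0_norm //.
  exact: exprn_ge0.
(* The radius grows from 0 to [M] in [m] steps of length [d = M / m]. As m > 8 L M, two steps move
   the averages by at most 2 d L <= 1/4, and m >= 2 keeps the overshoot [s + 2 * d] inside the disc
   of radius [2 * M]. *)
pose m := (Num.bound (8 * L * M)).+2.
have mE : 8 * L * M < m%:R.
  apply: lt_trans (archi_boundP _) _; first by rewrite !mulr_ge0 // ltW.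
  by rewrite ltr_nat.
have m2 : 2 <= m%:R :> R by rewrite ler_nat.
pose d := M / m%:R.
have d0 : 0 < d by rewrite divr_gt0 //; lra.
have dM : d * m%:R = M by rewrite divfK //; lra.
have step i : (i <= m)%N -> exists K, forall k : nat, (K <= k)%N -> Y (i%:R * d) k <= 8^-1.
  elim: i => [_|i IH im].
    exists 0%N => k _; rewrite YE mul0r // expr0n expn_eq0 /= mul0r.
    by rewrite invr_ge0.
  have [K HK] := IH (ltnW im).
  set s := i%:R * d in HK; have s0 : 0 <= s by rewrite mulr_ge0 // ltW.
  have sM : s + d <= M.
    have : i%:R + 1 <= m%:R :> R by rewrite natr1 ler_nat.
    by rewrite -dM /s; nra.
  have -> : i.+1%:R * d = s + d by rewrite -natr1 mulrDl mul1r.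
  have bnd (k : nat) : (K <= k)%N -> Y (s + 2 * d) k <= 1.
    move=> /HK hk.
    apply: near1_inv_1B (res_avgP Hl k _) _.
    have h1 := inv_1B_near1 (res_avgP Hl k _) hk.
    apply: le_trans (nrm_dist3 (res_avg res k s%:C) _ _) _.
    have := HL k s%:C (s + 2 * d)%:C.
    rewrite -rmorphB !absc_real opprD addrA subrr add0r normrN.
    rewrite !ger0_norm; [|lra|lra|lra].
    move=> /(_ _ _) h.
    have : |[res_avg res k s%:C - res_avg res k (s + 2 * d)%:C]| <= L * (2 * d).
      by apply: h; nra.
    have : L * (2 * d) <= 4^-1.
      have : (L * d * 8) * m%:R <= m%:R by nra.
      by rewrite -ler_pdivlMr ?divff; lra.
    by lra.
  (* Stepping back from [s + 2 * d] to [s + d] gains the factor [t ^+ (2 ^ k)], which tends to 0 and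
     improves the bound 1 to 1/8. *)
  pose t := (s + d) / (s + 2 * d).
  have t0 : 0 <= t by rewrite divr_ge0; lra.
  have t1 : t < 1 by rewrite ltr_pdivrMr; lra.
  have e0 : 0 < 8^-1 :> R by lra.
  have [K' HK'] := expr_lt_eps t0 t1 e0.
  exists (maxn K K') => k; rewrite geq_max => /andP[/bnd h /leq_trans h'].
  have {}h' := HK' _ (h' _ (ltnW (ltn_expl k (ltnSn 1)))).
  have -> : Y (s + d) k = t ^+ (2 ^ k) * Y (s + 2 * d) k.
    rewrite !YE; [|lra|lra]; rewrite mulrA -exprMn /t divfK //; lra.
  have : 0 <= t ^+ (2 ^ k) by exact: exprn_ge0.
  have : 0 <= Y (s + 2 * d) k by exact: nrm_ge0.
  by nra.
have [K /(_ K (leqnn K))] := step m (leqnn m).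
rewrite mulrC dM YE ?(ltW M0) // => h; exists (2 ^ K)%N; first by rewrite expn_gt0.
by lra.
Qed.

(** For [k != 0], [1 - k *: q] is [k] times [k^-1 - q], invertible because the spectrum is {0}; so
    the resolvent exists on the whole plane. *)
Lemma qnil_tnil q : qnil q -> tnil q.
Proof.
move=> Hq.
have inv k : exists y, y * (1 - k *: q) = 1 /\ (1 - k *: q) * y = 1.
  have [->|k0] := eqVneq k 0; first by exists 1; rewrite scale0r subr0 mulr1.
  have : ~ spectrum q k^-1 by rewrite Hq /=; apply/eqP; rewrite invr_eq0.
  move=> /contrapT [y [h h']]; exists (k^-1 *: y).
  have E : 1 - k *: q = k *: (k^-1%:A - q) by rewrite scalerBr scalerA divff ?scale1r.
  by rewrite E -!scalerAl -!scalerAr !scalerA mulVf ?divff // !scale1r.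
have [res Hres] := choice inv.
by apply: (@res_tnil q res) => k; have [] := Hres k.
Qed.

(** * Stability properties of quasinilpotent elements *)

Lemma comm_scalar b k : GRing.comm b k%:A.
Proof. by rewrite /GRing.comm -scalerAr -scalerAl mulr1 mul1r. Qed.

Lemma comm_inv b x y : x * y = 1 -> y * x = 1 -> GRing.comm b x -> GRing.comm b y.
Proof.
move=> xy yx bx; rewrite /GRing.comm.
by rewrite -[b * y]mul1r -yx -mulrA (mulrA x) -bx -!mulrA xy mulr1.
Qed.

(** If [z] inverts [x * y], then [y * z] is a right inverse and [z * y] a left inverse of [x], so
    they coincide. *)
Lemma invertible_factor x y : GRing.comm x y -> invertible (x * y) -> invertible x.
Proof.
move=> xy [z [h h']]; exists (y * z); split; first by rewrite mulrA.
have E : z * y * x = 1 by rewrite -mulrA -xy.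
by rewrite -[y * z]mul1r -E -!mulrA (mulrA x) (mulrA (x * y)) h mul1r mulrA E.
Qed.

Lemma invertibleZ k x : k != 0 -> invertible x -> invertible (k *: x).
Proof.
move=> k0 [y [h h']]; exists (k^-1 *: y).
by rewrite -!scalerAl -!scalerAr !scalerA h h' divff // mulVf // scale1r.
Qed.

(** Non-invertibility puts 0 into the spectrum; spectral radius zero excludes every other [k] by the
    Neumann series for [1 - q / k]. In this form, stability under commuting factors is immediate. *)
Lemma qnilP q : qnil q <-> ~ invertible q /\ tnil q.
Proof.
have inv0 : invertible (0%:A - q) <-> invertible q.
  rewrite scale0r sub0r; split=> [|h]; last first.
    by rewrite -scaleN1r; apply: invertibleZ; rewrite ?oppr_eq0 ?oner_eq0.
  by rewrite -{2}[q]opprK -(scaleN1r (- q)); apply: invertibleZ; rewrite oppr_eq0 oner_eq0.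
split=> [h | [h t]].
  split; last exact: qnil_tnil.
  by move=> /inv0; have : spectrum q 0 by rewrite h.
rewrite /qnil predeqE => k /=; split=> [nk|-> /inv0 //].
apply: contrapT => /eqP k0; apply: nk.
have -> : k%:A - q = k *: (1 - q * (k^-1)%:A).
  by rewrite -scalerAr mulr1 scalerBr scalerA divff // scale1r.
by apply: invertibleZ => //; apply: tnil_invertible_1B; apply: tnilM => //; exact: comm_scalar.
Qed.

Lemma qnilM q c : GRing.comm q c -> qnil q -> qnil (q * c).
Proof.
move=> qc /qnilP [h t]; apply/qnilP; split; last exact: tnilM.
by move=> /(invertible_factor qc).
Qed.

(** [k - q] is a commuting factor of [k^(n+1) - q^(n+1)], hence invertible for [k != 0]; and an
    inverse of [q] would yield one of its power. *)
Lemma qnilX_rev q n : qnil (q ^+ n.+1) -> qnil q.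
Proof.
move=> h; have qh k : k != 0 -> invertible (k%:A - q).
  move=> k0; have : ~ spectrum (q ^+ n.+1) (k ^+ n.+1).
    by rewrite h /=; apply/eqP; rewrite expf_neq0.
  move=> /contrapT.
  have kq : GRing.comm (k%:A) q by apply: commr_sym; exact: comm_scalar.
  have -> : (k ^+ n.+1)%:A = (k%:A : A) ^+ n.+1 by rewrite exprZn expr1n.
  rewrite subrXX_comm //; apply: invertible_factor.
  have cq x : GRing.comm x q -> GRing.comm (k%:A - q) x.
    move=> xq; apply: commr_sym; apply: commrB => //; exact: comm_scalar.
  apply: commr_sum => i _; apply: commrM; apply: commrX; apply: cq => //.
rewrite /qnil predeqE => k /=; split=> [nk|-> h0].
  by apply: contrapT => /eqP /qh.
have : spectrum (q ^+ n.+1) 0 by rewrite h.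
apply; rewrite scale0r sub0r; rewrite scale0r sub0r in h0.
have [y [e1 e2]] := h0; exists (- ((- y) ^+ n.+1)).
have qy : GRing.comm q (- y).
  by move: e1 e2; rewrite /GRing.comm !mulrN !mulNr => -> ->.
have q1 : q * - y = 1 by rewrite mulrN -mulNr.
by rewrite !mulrNN -!exprMn_comm // -qy q1 !expr1n.
Qed.

(** * Reductions to [a - a^(n+1)] *)

(** Multiply by [1 - (1 - a * x) * a ^+ n]. Where the idempotent [a * x] is 1, the given element is
    already [a - a^(n+1)] and the factor is 1; where it is 0, so is [x], and the product is
    [a * (1 - a^n)]. *)
Lemma qnil_sub_expr a x n : x * a * x = x -> a * x = x * a ->
  qnil (a - a ^+ n.+2 * x) -> qnil (a - a ^+ n.+1).
Proof.
move=> xax ax /(@qnilM _ (1 - (1 - a * x) * a ^+ n)).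
have cx b : GRing.comm b a -> GRing.comm b x -> GRing.comm b (1 - (1 - a * x) * a ^+ n).
  move=> ba bx; apply: commrB; first exact: commr1.
  by apply: commrM; [apply: commrB; [exact: commr1|exact: commrM] | exact: commrX].
have -> : (a - a ^+ n.+2 * x) * (1 - (1 - a * x) * a ^+ n) = a - a ^+ n.+1.
  have xn : x * a ^+ n = a ^+ n * x by apply: commrX.
  have k0 : x * (1 - a * x) = 0 by rewrite mulrBr mulr1 mulrA xax subrr.
  rewrite mulrBr mulr1 mulrA mulrBl -(mulrA _ x) k0 mulr0 subr0.
  rewrite mulrBr mulr1 mulrBl -exprS -!mulrA xn !mulrA -expr2 -exprD.
  by rewrite add2n opprB addrA subrK.
apply; apply: commr_sym; apply: commrB.
  by apply: commr_sym; apply: cx.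
by apply: commrM; [apply: commrX|]; apply: commr_sym; apply: cx.
Qed.

(** With [k = n - m], the product of [a^m - a^n] and [(1 - a^k)^(m-1)] is the [m]-th power of
    [a - a^(k+1)]. *)
Lemma qnil_sub_exprXX a m n : (0 < m)%N -> (m < n)%N ->
  qnil (a ^+ m - a ^+ n) -> qnil (a - a ^+ (n - m).+1).
Proof.
move=> m0 mn; set k := (n - m)%N; case: m m0 mn @k => // m _ mn k.
have ak : GRing.comm a (1 - a ^+ k) by apply: commrB; [exact: commr1|exact: commrX].
move=> /(@qnilM _ ((1 - a ^+ k) ^+ m)) h; apply: (@qnilX_rev _ m).
have -> : a - a ^+ k.+1 = a * (1 - a ^+ k) by rewrite mulrBr mulr1 exprS.
rewrite exprMn_comm // [(1 - _) ^+ m.+1]exprS mulrA mulrBr mulr1 -exprD.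
rewrite subnKC ?(ltnW mn) //; apply: h.
by apply: commrX; apply: commr_sym; apply: commrB; apply: commrX; apply: commr_sym.
Qed.

(** * Lifting to an idempotent and constructing the inverse *)

(** For [p = e + x * y], expanding gives p^2 - p = x ((2e - 1) y - 1 + x y^2), and the last
    hypothesis kills the bracket. *)
Lemma quadratic_idempotent e x y : GRing.comm e x -> GRing.comm e y ->
  GRing.comm x y -> x = e - e * e -> (e *+ 2 - 1) * y = 1 - x * (y * y) ->
  (e + x * y) * (e + x * y) = e + x * y.
Proof.
move=> ex ey xy xE E.
have {}E : x * (e * y) + x * (e * y) = x - x * (x * (y * y)) + x * y.
  have := congr1 (fun t => x * t + x * y) E.
  by rewrite mulrBl mul1r mulr2n mulrDl !mulrBr mulr1 subrK mulrDr.
rewrite mulrDl !mulrDr.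
have -> : e * (x * y) = x * (e * y) by rewrite mulrA ex -mulrA.
have -> : x * y * e = x * (e * y) by rewrite -mulrA -ey.
have -> : x * y * (x * y) = x * (x * (y * y)).
  by rewrite -mulrA (mulrA y) -xy -!mulrA.
rewrite -addrA (addrA (x * (e * y))) E addrAC subrK addrA.
by have -> : e * e + x = e by rewrite xE addrC subrK.
Qed.

(* The idempotent is [1/2 + (e - 1/2) (1 - 4 (e - e^2))^(-1/2)], with the inverse
   square root expressed through the Catalan generating function. *)
Lemma tnil_idempotent e : tnil (e - e * e) -> exists y,
  let p := e + (e - e * e) * y in
  p * p = p /\ forall b, GRing.comm b e -> GRing.comm b y.
Proof.
set Q := e - e * e => tQ.
have commQ b : GRing.comm b e -> GRing.comm b Q.
  by move=> be; apply: commrB => //; apply: commrM.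
pose f := e *+ 2 - 1.
have commf b : GRing.comm b e -> GRing.comm b f.
  by move=> be; apply: commrB; [apply: commrMn|exact: commr1].
have ff : f * f = 1 - Q * 4%:R.
  rewrite -expr2 sqrrB1 exprMn_n mulr_natr mulrnBl -mulrnA -expr2 opprB.
  by rewrite addrC.
have [j [fj jf]] : invertible f.
  apply: (@invertible_factor f f) => //; rewrite ff.
  by apply: tnil_invertible_1B; apply: tnilM => //; exact: commr_nat.
have commj b : GRing.comm b e -> GRing.comm b j.
  by move=> /commf; exact: comm_inv.
have je : GRing.comm e j by exact: commj.
(* With [y = j * c] the required equation [f * y = 1 - Q * (y * y)] becomes the Catalan equation for
   [c] at [z = - Q j^2]. *)
have tz : tnil (Q * - (j * j)).
  apply: tnilM => //; apply: commrN; apply: commrM; apply: commj;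
  apply: commr_sym; exact: commQ.
have [c [Ec commc]] := tnil_catalan tz.
have {}commc b : GRing.comm b e -> GRing.comm b c.
  by move=> be; apply: commc; apply: commrM; [exact: commQ|apply: commrN; apply: commrM; exact: commj].
have commy b : GRing.comm b e -> GRing.comm b (j * c).
  by move=> be; apply: commrM; [exact: commj|exact: commc].
exists (j * c) => /=; split=> //; set y := j * c in commy *.
have ye : y * e = e * y by rewrite commy.
have yQ : y * Q = Q * y by apply: commQ; exact: ye.
have fy : (e *+ 2 - 1) * y = c by rewrite mulrA fj mul1r.
have cy : c = 1 - Q * (y * y).
  have cj : j * c = c * j by apply: commc; exact: commr_sym.
  by rewrite {1}Ec -mulrA mulNr mulrN /y -!mulrA (mulrA c j) -cj -!mulrA.
by apply: quadratic_idempotent; [exact: commQ | exact: commy | exact/esym | | rewrite fy].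
Qed.

Lemma qnil_sub_expr_gpi a n : (0 < n)%N -> qnil (a - a ^+ n.+1) ->
  gpi_Hirano_invertible a.
Proof.
(* From here [n] is one less than in the statement: [q = a - a^(n+2)], and below [e = a^(n+1)]. *)
case: n => // n _; set q := a - _ => hq.
have [_ tq] : ~ invertible q /\ tnil q by apply/qnilP.
pose e := a ^+ n.+1.
have commq b : GRing.comm b a -> GRing.comm b q.
  by move=> ba; apply: commrB => //; apply: commrX.
have Qq : e - e * e = q * a ^+ n by rewrite /e /q mulrBl -exprS -!exprD !addnS !addSn.
have tQ : tnil (e - e * e).
  rewrite Qq; apply: tnilM tq; apply: commrX; apply: commr_sym; exact: commq.
have [y [/=]] := tnil_idempotent tQ.
have commQ b : GRing.comm b a -> GRing.comm b (e - e * e).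
  by move=> ba; rewrite Qq; apply: commrM; [exact: commq | exact: commrX].
move: tQ commQ Qq; set Q := e - e * e => tQ commQ Qq.
set p := e + Q * y => pp commy.
have {}commy b : GRing.comm b a -> GRing.comm b y.
  by move=> ba; apply: commy; exact: commrX.
have commQy b : GRing.comm b a -> GRing.comm b (Q * y).
  by move=> ba; apply: commrM; [exact: commQ | exact: commy].
have commp b : GRing.comm b a -> GRing.comm b p.
  by move=> ba; apply: commrD; [exact: commrX | exact: commQy].
have [v [uv vu]] : invertible (1 - Q * y).
  apply: tnil_invertible_1B; apply: tnilM => //.
  by apply: commy; apply: commr_sym; exact: commQ.
have commv b : GRing.comm b a -> GRing.comm b v.
  move=> ba; apply: comm_inv uv vu _.
  by apply: commrB; [exact: commr1 | exact: commQy].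
have ep : e * p = (1 - Q * y) * p.
  by rewrite mulrBl mul1r -{2}pp -mulrBl /p addrK.
(* Since [e * p = (1 - Q * y) * p] and [v] inverts [1 - Q * y], this choice makes [a * x] equal to
   [p]. *)
pose x := a ^+ n * v * p.
have ax : a * x = p.
  rewrite /x !mulrA -exprS -/e -mulrA (_ : v * p = p * v).
    by rewrite mulrA ep -mulrA (_ : p * v = v * p) ?mulrA ?uv ?mul1r //;
       apply/commr_sym/commp/commr_sym/commv.
  exact/commp/commr_sym/commv.
have xa : x * a = a * x.
  apply: commr_sym; apply: commrM; last exact: commp.
  by apply: commrM; [exact: commrX | exact: commv].
exists x; split=> //.
  by rewrite -mulrA ax /x -(mulrA _ p p) pp.
exists n.+1 => //.
(* As [a * x = p], the left side is [q + a * e * (1 - p)]. Here [e * (1 - p) = - Q * y * (1 - p)]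
   because [e = p - Q * y], and [a * Q = q * a^(n+1)], so [q] factors out. *)
have -> : a - a ^+ n.+3 * x = q * (1 - a ^+ n.+1 * (y * (1 - p))).
  have p0 : p * (1 - p) = 0 by rewrite mulrBr mulr1 pp subrr.
  have eE : e = p - Q * y by rewrite /p addrK.
  have e1p : Q * (y * (1 - p)) = - (e * (1 - p)).
    by rewrite eE [(p - _) * _]mulrBl p0 sub0r opprK mulrA.
  have qa : q * a ^+ n.+1 = a * Q by rewrite exprSr mulrA -Qq commQ.
  rewrite exprSr -mulrA ax mulrBr mulr1 (mulrA q) qa -mulrA e1p mulrN opprK.
  by rewrite (mulrA a) -exprS mulrBr mulr1 addrA subrK.
apply: qnilM => //; apply: commr_sym; apply: commq; apply: commr_sym.
apply: commrB; first exact: commr1.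
apply: commrM; first exact: commrX.
by apply: commrM; [exact: commy | apply: commrB; [exact: commr1 | exact: commp]].
Qed.

End BanachAlgebra.

Unset Implicit Arguments.

(** * The cycle of implications *)

Theorem theorem2p2 (R : realType) (A : algType R[i]) (N : banach_norm A) (a : A) :
  [<-> gpi_Hirano_invertible a;
       exists2 n : nat, (0 < n)%N & qnil (A:=A) (a - a ^+ n.+1);
       exists m n : nat, [/\ (0 < m)%N, (0 < n)%N, m <> n &
                            qnil (A:=A) (a ^+ m - a ^+ n)]].
Proof.
tfae.
- move=> [x [xax ax [n n0 h]]]; exists n => //.
  exact: qnil_sub_expr N _ _ _ xax ax h.
- move=> [n n0 h]; exists 1%N, n.+1; split=> //.
  by case: n n0 {h}.
- move=> [m [n [m0 n0 /eqP mn h]]].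
  (* The third condition returns to the first through the second, with [k] the distance between the
     exponents. *)
  have [k k0 hk] : exists2 k, (0 < k)%N & qnil (a - a ^+ k.+1).
    move: mn; rewrite neq_ltn => /orP[mn | nm].
      by exists (n - m)%N; [rewrite subn_gt0 | exact: qnil_sub_exprXX N _ _ _ m0 mn h].
    exists (m - n)%N; first by rewrite subn_gt0.
    (* The opposite order of exponents only changes the sign, absorbed as multiplication by the
       central element [-1]. *)
    apply: (qnil_sub_exprXX N n0 nm); rewrite -opprB -mulrN1.
    by apply: (qnilM N) => //; exact/commrN/commr1.
  exact: qnil_sub_expr_gpi N _ _ k0 hk.
Qed.
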